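(* Let $j\ge2$ and define \[ H(j):=\begin{vmatrix} \langle f_2,f_2\rangle &\langle f_2,f_3\rangle &\dots &\langle f_2,f_{j-1}\rangle &1/2\\ \langle f_3,f_2\rangle &\langle f_3,f_3\rangle &\dots &\langle f_3,f_{j-1}\rangle &2/3\\ \vdots &\vdots& &\vdots &\vdots\\ \langle f_j,f_2\rangle &\langle f_j,f_3\rangle &\dots &\langle f_j,f_{j-1}\rangle &(j-1)/j \end{vmatrix}, \] the $(j-1)\times(j-1)$ determinant whose row indexed by $f_i$ ($2\le i\le j$) has entries $\langle f_i,f_2\rangle,\dots,\langle f_i,f_{j-1}\rangle$ followed by $(i-1)/i$ (for $j=2$, $H(2)=1/2$). If $H(j)>0$, then there exists $k_0(j)$ such that $\langle e_j,f_k\rangle>0$ for all $k\ge k_0(j)$.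
   Context: For each integer $k\ge2$, $f_k:(0,1]\to\mathbb{R}$ is defined by $f_k(x):=\frac{1}{k}\bigl[\frac{1}{x}\bigr]-\bigl[\frac{1}{kx}\bigr]$, where $[t]$ is the integer part of $t$; $\langle g,h\rangle:=\int_0^1 gh\,dx$. $(e_j)_{j\ge2}$ is the unique orthonormal sequence in $L^2(0,1)$ with $\operatorname{span}\{e_2,\dots,e_k\}=\operatorname{span}\{f_2,\dots,f_k\}$ and $\langle e_k,f_k\rangle>0$ for all $k\ge2$ (Gram--Schmidt applied to the linearly independent sequence $(f_k)$). *)

(* Defs.v *)
From HB Require Import structures.
From mathcomp Require Import all_boot all_order all_algebra.
From mathcomp Require Import all_classical all_reals all_analysis.

Set Implicit Arguments.
Unset Strict Implicit.
Unset Printing Implicit Defensive.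

Import Order.TTheory GRing.Theory Num.Theory.
Import numFieldNormedType.Exports.

Local Open Scope classical_set_scope.
Local Open Scope ring_scope.

(* Elements of L^2(0,1) are represented by Borel functions on the whole line
   that are square integrable for this measure; they matter only up to
   equality almost everywhere. *)
Definition mu01 (R : realType) : {measure set (measurableTypeR R) -> \bar R} :=
  mrestr (@lebesgue_measure R) (measurable_itv `]0%R, 1%R[).

Definition ip (R : realType) (g h : R -> R) : R :=
  \int[mu01 R]_x (g x * h x).

(* Only k >= 2 and 0 < x < 1 matter. *)
Definition f (R : realType) (k : nat) (x : R) : R :=
  k%:R^-1 * (Num.floor x^-1)%:~R - (Num.floor (k%:R * x)^-1)%:~R.

(* The linear span of the classes of u_2, ..., u_k in L^2(0,1). *)
Definition L2span (R : realType) (u : nat -> R -> R) (k : nat) : set (R -> R) :=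
  [set g | g \in Lfun (mu01 R) 2%:E /\
    exists c : nat -> R,
      g = (fun x => \sum_(2 <= i < k.+1) c i * u i x) %[ae mu01 R]].

(* The values e_0 and e_1 are unconstrained; for j >= 2 these conditions
   determine e_j up to equality almost everywhere. *)
Definition gram_schmidt_of_f (R : realType) (e : nat -> R -> R) : Prop :=
  [/\ forall j, (2 <= j)%N -> e j \in Lfun (mu01 R) 2%:E,
      forall i j, (2 <= i)%N -> (2 <= j)%N -> ip (e i) (e j) = (i == j)%:R,
      forall k, (2 <= k)%N -> L2span e k = L2span (@f R) k
    & forall k, (2 <= k)%N -> 0 < ip (e k) (f k)].

(* Row r and column s, numbered from 0, correspond to f_(r + 2) and f_(s + 2);
   the last column, s = j - 2, holds (i - 1) / i in the row of f_i. *)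
Definition H (R : realType) (j : nat) : R :=
  \det (\matrix_(r < j.-1, s < j.-1)
    if (s.+2 < j)%N then ip (@f R r.+2) (f s.+2) else r.+1%:R / r.+2%:R).

(* Main.v *)
(**
On ]1/(n+1), 1/n] one has f_k = (n mod k)/k.  Hence k <f_i, f_k> equals
sum_(n < k) (n mod i)/(i (n+1)) up to an error in [0, 1] coming from ]0, 1/k],
and since n mod i has mean (i-1)/2 over a period, Abel summation gives
k <f_i, f_k> = (i-1)/(2i) h_k + O(1), where h_k is the k-th harmonic number.
Writing e_j = sum_i c_i f_i, it remains to see that sum_i c_i (i-1)/i > 0.
Orthogonality says that c times the Gram matrix of f_2, ..., f_j is p times the
last unit vector, with p = <e_j, f_j> > 0 and c_j p = <e_j, e_j> = 1.
Multiplying c by the matrix of H(j) instead replaces p by sum_i c_i (i-1)/i;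
Cramer's rule then gives
c_j H(j) = (sum_i c_i (i-1)/i) det Gram(f_2, ..., f_(j-1)),
and the Gram determinants are positive by the same identity and induction.
*)
Require Import Defs.
From mathcomp Require Import all_boot all_order all_algebra.
From mathcomp Require Import all_classical all_reals all_analysis.
From mathcomp Require Import measurable_realfun.
From mathcomp Require Import zify ring lra.
Set Implicit Arguments.
Unset Strict Implicit.
Unset Printing Implicit Defensive.
Import Order.TTheory GRing.Theory Num.Theory.
Import numFieldNormedType.Exports.
Local Open Scope classical_set_scope.
Local Open Scope ring_scope.

(** * Pointwise values of [f] and the measure on ]0, 1[ *)

(** Nested floors: the integer part of 1/(kx) depends only on that of 1/x and equals [n %/ k], so
    what remains is the fractional part of n/k. *)
Lemma f_floor_nat (R : realType) (k n : nat) (x : R) : (0 < k)%N ->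
  Num.floor x^-1 = n%:Z -> f k x = (n %% k)%:R / k%:R.
Proof.
move=> k0 nE; have /andP[nx xn] := floor_itv x^-1.
have k0' : 0 < k%:R :> R by rewrite ltr0n.
have fl : Num.floor (k%:R * x)^-1 = (n %/ k)%:Z.
  apply: floor_def; rewrite invfM mulrC; move: nx xn; rewrite nE => nx xn.
  rewrite ler_pdivlMr// ltr_pdivrMr//; apply/andP; split.
    by rewrite (le_trans _ nx)// -natrM ler_nat leq_divM.
  rewrite (lt_le_trans xn)// !intrD -!pmulrn !natr1 -natrM ler_nat.
  by have := ltn_ceil n k0; rewrite mulnC; lia.
rewrite /f nE fl -!pmulrn; have {1}-> := divn_eq n k.
by rewrite natrD natrM; field; rewrite gt_eqF.
Qed.

(** Stated on the whole line because integrability and the comparisons in [ip_f_estimate] are over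
    [setT]. *)
Lemma f_ge0_le1 (R : realType) (k : nat) (x : R) : (0 < k)%N ->
  0 <= f k x <= 1.
Proof.
move=> k0; have k0' : 0 < k%:R :> R by rewrite ltr0n.
rewrite /f invfM; set t := x^-1; set q := Num.floor (k%:R^-1 * t).
have /andP[nt tn] := floor_itv t; have /andP[qt tq] := floor_itv (k%:R^-1 * t).
have h1 : (q * k%:Z <= Num.floor t)%R.
  by rewrite floor_ge_int intrM -ler_pdivlMr// mulrC.
have h2 : (Num.floor t < (q + 1) * k%:Z)%R.
  by rewrite floor_lt_int intrM -ltr_pdivrMr// mulrC.
rewrite -(ler_int R) intrM in h1; rewrite -(ltr_int R) intrM in h2.
rewrite subr_ge0 lerBlDr ler_pdivlMl// ler_pdivrMl//.
by rewrite intrD in h2; apply/andP; split; nra.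
Qed.

Lemma measurable_inv (R : realType) : measurable_fun setT (@GRing.inv R).
Proof.
have -> : setT = [set x : R | x != 0] `|` [set 0].
  by apply/seteqP; split=> // x _ /=; have [->|] := eqVneq x 0; [right|left].
have oN0 : open [set x : R | x != 0] by exact: open_neq.
apply/measurable_funU => //; first exact: open_measurable.
split; last exact: measurable_fun_set1.
apply: open_continuous_measurable_fun => // x; rewrite inE/= => x0.
exact: inv_continuous.
Qed.

Lemma measurable_f (R : realType) (k : nat) : measurable_fun setT (@f R k).
Proof.
have mfl : measurable_fun setT (fun t : R => (Num.floor t)%:~R : R).
  apply: nondecreasing_measurable => // s t st.
  by rewrite ler_int le_floor.
apply: measurable_funB.
  apply: measurable_funM => //.
  exact: (measurableT_comp mfl (@measurable_inv R)).
apply: (measurableT_comp mfl).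
apply: (measurableT_comp (@measurable_inv R)).
exact: measurable_funM.
Qed.

Lemma mu01_le1 (R : realType) (A : set R) : measurable A -> (mu01 R A <= 1)%E.
Proof.
move=> mA; rewrite /mu01 /= /mrestr.
apply: (@le_trans _ _ (@lebesgue_measure R `]0, 1[%classic)).
  by apply: le_measure; rewrite ?inE//; exact: measurableI.
by rewrite lebesgue_measure_itv/= lte_fin ltr01 sube0.
Qed.

Lemma mu01_itvoc (R : realType) (a b : R) : 0 <= a -> a <= b -> b <= 1 ->
  mu01 R `]a, b]%classic = (b - a)%:E.
Proof.
move=> a0 ab b1; rewrite /mu01 /= /mrestr.
(* The trace of ]a, b] on ]0, 1[ loses b when b = 1, so it is squeezed between ]a, b[ and ]a, b],
   both of length b - a. *)
have E (i : interval R) : i.1 = BRight a -> (i.2 = BLeft b \/ i.2 = BRight b) ->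
    @lebesgue_measure R [set` i] = (b - a)%:E.
  case: i => u v /= -> [] ->; rewrite lebesgue_measure_itv/= lte_fin;
  by case: ltgtP ab => // -> _; rewrite subrr.
apply/eqP; rewrite eq_le; apply/andP; split.
  rewrite -(E `]a, b]) //=; last by right.
  by apply: le_measure; rewrite ?inE//; exact: measurableI.
rewrite -(E `]a, b[) //=; last by left.
apply: le_measure; rewrite ?inE//; first exact: measurableI.
move=> x /=; rewrite !in_itv/= => /andP[ax xb].
by rewrite ax ltW// (le_lt_trans a0 ax) (lt_le_trans xb b1).
Qed.

(** * Determinants *)

(** Multiply on the right by the adjugate: the last coordinate is [a] times the corner cofactor,
    whose sign is +1. It serves both for the Gram matrices and for the matrix of [H]. *)
Lemma row_mul_det (R : comNzRingType) (n : nat) (M : 'M[R]_n.+1)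
    (c : 'rV[R]_n.+1) (a : R) :
  c *m M = a *: delta_mx 0 ord_max ->
  c 0 ord_max * \det M = a * \det (row' ord_max (col' ord_max M)).
Proof.
move=> cM.
have /matrixP/(_ 0 ord_max) : c *m M *m \adj M = a *: delta_mx 0 ord_max *m \adj M.
  by rewrite cM.
rewrite -mulmxA mul_mx_adj mul_mx_scalar !mxE mulrC => ->.
rewrite (bigD1 ord_max)//= big1 ?addr0 => [|s sn]; last first.
  by rewrite !mxE (negbTE sn) andbF mulr0 mul0r.
by rewrite !mxE !eqxx mulr1 /cofactor -signr_odd oddD addbb expr0 mul1r.
Qed.

Lemma det_gram_gt0 (R : realFieldType) (g : nat -> nat -> R) :
  (forall n, exists (c : 'rV[R]_n.+1) (p : R),
    [/\ 0 < p, 0 < c 0 ord_max &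
      c *m (\matrix_(r < n.+1, s < n.+1) g r s) = p *: delta_mx 0 ord_max]) ->
  forall n, 0 < \det (\matrix_(r < n, s < n) g r s).
Proof.
move=> gP; elim=> [|n IHn]; first by rewrite det_mx00.
have [c [p [p0 c0 /row_mul_det cE]]] := gP n.
suff: 0 < c 0 ord_max * \det (\matrix_(r < n.+1, s < n.+1) g r s).
  by rewrite pmulr_rgt0.
rewrite cE pmulr_rgt0//.
suff -> : row' ord_max (col' ord_max (\matrix_(r < n.+1, s < n.+1) g r s)) =
    \matrix_(r < n, s < n) g r s :> 'M[R]_n by [].
by apply/matrixP => r s; rewrite !mxE !lift_max.
Qed.

(** * Harmonic sums *)

(** Full periods sum to 0; the last r = m mod i terms give r(r - 1)/2 - r(i - 1)/2. *)
Lemma sum_modn_centered (R : realFieldType) (i m : nat) : (0 < i)%N ->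
  \sum_(0 <= n < m) ((n %% i)%:R - (i%:R - 1) / 2) =
  - ((m %% i)%:R * (i%:R - (m %% i)%:R)) / 2 :> R.
Proof.
move=> i0; elim: m => [|m IHm]; first by rewrite big_geq// mod0n; field.
rewrite big_nat_recr//= IHm modnS; case: ifPn => [im|_].
  (* A period ends at this step, so m mod i = i - 1. *)
  have -> : (i%:R : R) = (m %% i)%:R + 1.
    rewrite natr1; congr _%:R.
    have /dvdn_leq : (i %| (m %% i).+1)%N.
      by move: im; rewrite {1}(divn_eq m i) -addnS dvdn_addr ?dvdn_mull.
    by have := ltn_pmod m i0; lia.
  by field.
by rewrite -natr1; field.
Qed.

Lemma abel_harmonic_bound (R : realFieldType) (d : nat -> R) (B : R) :
  (forall m, `|\sum_(0 <= n < m) d n| <= B) ->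
  forall m, `|\sum_(0 <= n < m) d n / n.+1%:R| <= B.
Proof.
move=> dB.
have B0 : 0 <= B by have := dB 0; rewrite big_geq// normr0.
(* Summation by parts: without its boundary term, the sum telescopes. *)
have key m : `|\sum_(0 <= n < m.+1) d n / n.+1%:R
    - (\sum_(0 <= n < m.+1) d n) / m.+1%:R| <= B * (1 - m.+1%:R^-1).
  elim: m => [|m IHm]; first by rewrite !big_nat1 subrr normr0 invr1 subrr mulr0.
  set D := \sum_(0 <= n < m.+1) d n in IHm *.
  set T := \sum_(0 <= n < m.+1) _ in IHm *.
  have -> : \sum_(0 <= n < m.+2) d n / n.+1%:R
      - (\sum_(0 <= n < m.+2) d n) / m.+2%:R =
    (T - D / m.+1%:R) + D * (m.+1%:R^-1 - m.+2%:R^-1).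
    by rewrite big_nat_recr//= [X in _ - X / _]big_nat_recr//= -/D -/T; ring.
  have q0 : 0 <= m.+1%:R^-1 - m.+2%:R^-1 :> R.
    by rewrite subr_ge0 lef_pV2 ?posrE// ler_nat.
  rewrite (le_trans (ler_normD _ _))// normrM (ger0_norm q0).
  have := ler_wpM2r q0 (dB m.+1); rewrite -/D; move: IHm.
  move: (m.+1%:R^-1) (m.+2%:R^-1) (T - _) => a b t.
  by rewrite !mulrBr !mulr1; lra.
case=> [|m]; first by rewrite big_geq// normr0.
have := key m; have := dB m.+1.
set D := \sum_(0 <= n < m.+1) d n; set T := \sum_(0 <= n < m.+1) _ => DB TB.
rewrite -(subrK (D / m.+1%:R) T) (le_trans (ler_normD _ _))//.
have q0 : 0 <= m.+1%:R^-1 :> R by rewrite invr_ge0.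
rewrite normrM (ger0_norm q0); have := ler_wpM2r q0 DB; move: TB.
by move: (m.+1%:R^-1) (T - _) => a t; rewrite !mulrBr !mulr1; lra.
Qed.

Lemma sum_modn_harmonic (R : realFieldType) (i : nat) : (0 < i)%N ->
  exists B : R, forall m,
    `|\sum_(0 <= n < m) (n %% i)%:R / n.+1%:R
      - (i%:R - 1) / 2 * \sum_(0 <= n < m) n.+1%:R^-1| <= B.
Proof.
(* The centred partial sums are r(i - r)/2 in absolute value with 0 <= r <= i, so i^2 is ample. *)
move=> i0; exists (i%:R * i%:R) => m.
rewrite mulr_sumr -sumrB.
under eq_bigr do rewrite -mulrBl.
apply: abel_harmonic_bound => {}m; rewrite sum_modn_centered//.
have r0 : 0 <= (m %% i)%:R :> R by [].
have ri : (m %% i)%:R <= i%:R :> R by rewrite ler_nat ltnW// ltn_pmod.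
by rewrite ler_norml; apply/andP; split; nra.
Qed.

Lemma harmonic_unbounded (R : realType) (B : R) :
  exists k0 : nat, forall k : nat, (k0 <= k)%N ->
    B < \sum_(0 <= n < k) n.+1%:R^-1.
Proof.
have nd : nondecreasing_seq (series (@harmonic R)).
  by apply/nondecreasing_series => n _ _; exact: harmonic_ge0.
have /cvgryPgt/(_ B) [k0 _ k0P] := nondecreasing_dvgn_lt nd (@dvg_harmonic R).
by exists k0 => k /k0P.
Qed.

(** * Integrability and linearity of [ip] *)

Section Rintegral_linear_combination.
Context d (T : measurableType d) (R : realType).
Variables (mu : {measure set T -> \bar R}) (I : Type).
Variables (c : I -> R) (v : I -> T -> R).
Hypothesis intv : forall i, mu.-integrable setT (EFin \o v i).

Lemma integrable_lin_comb (s : seq I) :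
  mu.-integrable setT (EFin \o (fun x => \sum_(i <- s) c i * v i x)).
Proof.
have -> : EFin \o (fun x => \sum_(i <- s) c i * v i x) =
    (fun x => \sum_(i <- s) (c i)%:E * (v i x)%:E)%E.
  by apply/funext => x /=; rewrite -sumEFin.
apply: integrable_sum => // i _; exact: (integrableZl _ _ (intv i)).
Qed.

Lemma Rintegral_lin_comb (s : seq I) :
  \int[mu]_x (\sum_(i <- s) c i * v i x) = \sum_(i <- s) c i * \int[mu]_x v i x.
Proof.
elim: s => [|i s IHs].
  by under eq_Rintegral do rewrite big_nil; rewrite Rintegral_cst// mul0r big_nil.
under eq_Rintegral do rewrite big_cons.
rewrite RintegralD//; last exact: integrable_lin_comb.
  by rewrite RintegralZl// IHs big_cons.
have -> : EFin \o (fun x => c i * v i x) = (fun x => (c i)%:E * (v i x)%:E)%E by [].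
exact: (integrableZl _ _ (intv i)).
Qed.

End Rintegral_linear_combination.

Lemma mu01_integrable (R : realType) (g : R -> R) (B : R) :
  measurable_fun setT g -> (forall x, `|g x| <= B) ->
  (mu01 R).-integrable setT (EFin \o g).
Proof.
move=> mg gB; apply: measurable_bounded_integrable => //.
  by rewrite (le_lt_trans (mu01_le1 measurableT))// ltry.
by exists B; split; rewrite ?num_real// => y /ltW By x _; exact: le_trans By.
Qed.

Lemma f_norm_le1 (R : realType) (k : nat) (x : R) : (0 < k)%N -> `|f k x| <= 1.
Proof.
by move=> k0; have /andP[h1 h2] := f_ge0_le1 x k0; rewrite ger0_norm.
Qed.

Lemma f_Lfun (R : realType) (k : nat) : (0 < k)%N -> @f R k \in Lfun (mu01 R) 2%:E.
Proof.
move=> k0; rewrite inE/=; apply/andP; split; rewrite inE/=.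
  exact: measurable_f.
rewrite /finite_norm unlock poweR_lty//.
have -> : (fun x => `|(EFin \o @f R k) x| `^ 2)%E =
    EFin \o (fun x => (f k x) ^+ 2).
  apply/funext => x /=; rewrite powR_mulrn// -normrX ger0_norm//.
  exact: sqr_ge0.
apply: integrable_lty => //.
apply: (@mu01_integrable _ _ 1) => [|x].
  apply: measurable_funX; exact: measurable_f.
by rewrite normrX expr_le1// f_norm_le1.
Qed.

Lemma ip_sym (R : realType) (g h : R -> R) : ip g h = ip h g.
Proof. by apply: eq_Rintegral => x _; rewrite mulrC. Qed.

Lemma ip_ae_sum (R : realType) (u : nat -> R -> R) (k : nat) (c : nat -> R)
    (h g : R -> R) :
  (forall i, (2 <= i)%N -> u i \in Lfun (mu01 R) 2%:E) ->
  h \in Lfun (mu01 R) 2%:E -> g \in Lfun (mu01 R) 2%:E ->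
  h = (fun x => \sum_(2 <= i < k.+1) c i * u i x) %[ae mu01 R] ->
  ip h g = \sum_(2 <= i < k.+1) c i * ip (u i) g.
Proof.
move=> uL hL gL hu.
have intg v : v \in Lfun (mu01 R) 2%:E ->
    (mu01 R).-integrable setT (EFin \o (fun x => v x * g x)).
  by move=> vL; apply/Lfun1_integrable; exact: Lfun2_mul_Lfun1.
(* [u 0] and [u 1] are unconstrained, while [Rintegral_lin_comb] asks for integrability at every
   index; [w] replaces both by 0. *)
pose w i := if (2 <= i)%N then u i else cst 0.
have wI i : (mu01 R).-integrable setT (EFin \o (fun x => w i x * g x)).
  rewrite /w; case: ifPn => [i2|_]; first exact/intg/uL.
  have -> : (fun x => cst 0 x * g x) = cst 0.
    by apply/funext => x /=; rewrite mul0r.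
  by apply: (@mu01_integrable _ _ 0) => // x; rewrite normr0.
transitivity (\int[mu01 R]_x (\sum_(2 <= i < k.+1) c i * (w i x * g x))).
  congr fine; apply: ae_eq_integral => //.
  - by have /integrableP[] := intg h hL.
  - by have /integrableP[] := integrable_lin_comb c wI (index_iota 2 k.+1).
  - apply: (@filterS _ _ (ae_filter_ringOfSetsType (mu01 R))) hu => x /= hx _; rewrite hx// mulr_suml.
    congr EFin; apply: eq_big_nat => i /andP[i2 _].
    by rewrite /w i2 mulrA.
rewrite Rintegral_lin_comb//; apply: eq_big_nat => i /andP[i2 _].
by rewrite /w i2.
Qed.

(** * Asymptotics of [ip (f i) (f k)] *)

Lemma ip_f_estimate (R : realType) (i k : nat) : (0 < i)%N -> (0 < k)%N ->
  0 <= k%:R * ip (@f R i) (f k)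
    - \sum_(0 <= n < k) (n %% i)%:R / i%:R / n.+1%:R <= 1.
Proof.
move=> i0 k0; set S := \sum_(0 <= n < k) _.
have k0' : 0 < k%:R :> R by rewrite ltr0n.
have i0' : 0 < i%:R :> R by rewrite ltr0n.
(* [p] is squeezed between the step function [g], which agrees with it for
   [x > 1/k], and [g] plus [k] on ]-oo, 1/k].  The term [n = 0] of [g] is
   harmless: [w 0 = 0]. *)
pose w n : R := n%:R * ((n %% i)%:R / i%:R).
pose J n : set R := `]n.+1%:R^-1, n%:R^-1]%classic.
pose J0 : set R := `]-oo, k%:R^-1]%classic.
pose g x := \sum_(0 <= n < k) w n * \1_(J n) x.
pose p x : R := k%:R * (f i x * f k x).
have gE x n : 0 < x -> Num.floor x^-1 = n%:Z -> g x = if (n < k)%N then w n else 0.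
  move=> x0 nE.
  (* For m > 0, x lies in [J m] exactly when m is the floor of 1/x. *)
  transitivity (\sum_(0 <= m < k | m == n) w m); last by rewrite big_nat1_eq.
  rewrite [RHS]big_mkcond; apply: eq_bigr => m _.
  case: m => [|m]; first by rewrite /w !mul0r if_same.
  rewrite indicE /J mem_setE in_itv/= invf_plt ?posrE// invf_pge ?posrE//.
  have -> : (x^-1 < m.+2%:R) && (m.+1%:R <= x^-1) = (m.+1 == n).
    rewrite andbC -eqz_nat -nE eq_sym floor_eq.
    by rewrite intrD -!pmulrn natr1.
  by case: eqP => _; rewrite ?mulr1 ?mulr0.
have g0 x : x <= 0 -> g x = 0.
  move=> x0; rewrite /g big1// => m _; rewrite indicE /J mem_setE in_itv/=.
  by rewrite ltNge (le_trans x0)// mulr0.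
have fl (x : R) : 0 < x -> exists n : nat, Num.floor x^-1 = n%:Z.
  move=> x0; have : 0 <= Num.floor x^-1 by rewrite floor_ge0 invr_ge0 ltW.
  by case: (Num.floor x^-1) => // n _; exists n.
have p0 x : 0 <= p x.
  by apply: mulr_ge0 => //; apply: mulr_ge0;
    [have /andP[] := f_ge0_le1 x i0|have /andP[] := f_ge0_le1 x k0].
have pk x : p x <= k%:R.
  have /andP[? ?] := f_ge0_le1 x i0; have /andP[? ?] := f_ge0_le1 x k0.
  by rewrite /p ger_pMr// mulr_ile1.
have pE x n : 0 < x -> Num.floor x^-1 = n%:Z -> (n < k)%N -> p x = w n.
  move=> x0 nE nk; rewrite /p (f_floor_nat i0 nE) (f_floor_nat k0 nE).
  by rewrite (modn_small nk) /w; field; rewrite !gt_eqF.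
have gp x : g x <= p x.
  have [x0|x0] := leP x 0; first by rewrite g0.
  have [n nE] := fl x x0; rewrite (gE _ _ x0 nE); case: ifPn => // nk.
  by rewrite (pE _ _ x0 nE).
have pg x : p x <= g x + k%:R * \1_J0 x.
  have k1 : 0 <= k%:R * \1_J0 x :> R by rewrite mulr_ge0// indicE.
  (* [mu01] ignores x <= 0, but the comparison is made on the whole line; this is why [J0] is
     unbounded below. *)
  have [x0|x0] := leP x 0.
    have xk : x <= k%:R^-1 by rewrite (le_trans x0)// invr_ge0 ltW.
    by rewrite g0// add0r indicE /J0 mem_setE in_itv/= xk mulr1.
  have [n nE] := fl x x0; rewrite (gE _ _ x0 nE); case: ltnP => [nk|kn].
    by rewrite (pE _ _ x0 nE)// lerDl.
  rewrite add0r indicE /J0 mem_setE in_itv/= invf_pge ?posrE//.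
  have /andP[nx _] := floor_itv x^-1; rewrite nE in nx.
  by rewrite (le_trans _ nx) ?mulr1// -pmulrn ler_nat.
have iI (A : set R) : measurable A ->
    (mu01 R).-integrable setT (EFin \o (\1_A : R -> R)).
  move=> mA; apply: (@mu01_integrable _ _ 1) => [|x].
    exact: measurable_indic.
  by rewrite indicE; case: (_ \in _); rewrite ?normr1 ?normr0.
have mJ n : measurable (J n) by exact: measurable_itv.
have mJ0 : measurable J0 by exact: measurable_itv.
have iJ n := iI _ (mJ n).
have iJ0 := iI _ mJ0.
have ikJ0 : (mu01 R).-integrable setT (EFin \o (fun x => k%:R * \1_J0 x)).
  exact: (integrableZl _ _ iJ0).
have ig : (mu01 R).-integrable setT (EFin \o g) by exact: integrable_lin_comb.
have iff : (mu01 R).-integrable setT (EFin \o (fun x => f i x * f k x)).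
  by apply/Lfun1_integrable; apply: Lfun2_mul_Lfun1; exact: f_Lfun.
have ipp : (mu01 R).-integrable setT (EFin \o p) by exact: (integrableZl _ _ iff).
have Ip : \int[mu01 R]_x p x = k%:R * ip (f i) (f k) by rewrite RintegralZl.
(* For n > 0, [J n] has length 1/n - 1/(n + 1) = 1/(n (n + 1)), and the factor n of [w n]
   cancels. *)
have Ig : \int[mu01 R]_x g x = S.
  rewrite Rintegral_lin_comb//; apply: eq_bigr => -[|n] _.
    by rewrite /w mod0n !mul0r.
  rewrite /Rintegral integral_indic//; last exact: mJ.
  rewrite setIT mu01_itvoc//=.
  - by rewrite /w; field; rewrite !gt_eqF//= ltr_wpDl.
  - by rewrite lef_pV2 ?posrE// ler_nat.
  - by rewrite invf_le1// ler1n.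
(* [J0] has mass 1/k: only ]0, 1/k] counts for [mu01]. *)
have IJ0 : k%:R * \int[mu01 R]_x \1_J0 x = 1.
  rewrite /Rintegral integral_indic//.
  rewrite setIT.
  suff -> : mu01 R J0 = mu01 R `]0, k%:R^-1]%classic.
    rewrite mu01_itvoc//= ?subr0 ?divff ?gt_eqF ?invr_ge0 ?invf_le1// ?ler1n//.
  rewrite /mu01/= /mrestr; congr lebesgue_measure; rewrite /J0; apply/seteqP.
  by split=> x /=; rewrite !in_itv/= => -[]; [move=> -> /andP[-> ->]|move=> /andP[_ ->]].
rewrite -Ip -Ig subr_ge0 lerBlDl; apply/andP; split; first exact: le_Rintegral.
rewrite -IJ0 -RintegralZl// -RintegralD//.
apply: le_Rintegral => //.
exact: (integrableD measurableT ig ikJ0).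
Qed.

Lemma ip_f_asymptotic (R : realType) (i : nat) : (0 < i)%N ->
  exists C : R, forall k, (0 < k)%N ->
    `|k%:R * ip (@f R i) (f k)
      - (i%:R - 1) / i%:R / 2 * \sum_(0 <= n < k) n.+1%:R^-1| <= C.
Proof.
move=> i0; have [B BP] := sum_modn_harmonic R i0.
(* The first term is the bound of [sum_modn_harmonic] divided by i; the 1 is the error in
   [ip_f_estimate]. *)
exists (i%:R^-1 * B + 1) => k k0; have := ip_f_estimate R i0 k0.
have i1 : 0 <= i%:R^-1 :> R by rewrite invr_ge0.
have := ler_wpM2l i1 (BP k); rewrite -[X in X * `|_|]ger0_norm// -normrM mulrBr.
rewrite mulr_sumr; under eq_bigr do rewrite mulrA [_^-1 * _]mulrC.
have -> (h : R) : i%:R^-1 * ((i%:R - 1) / 2 * h) = (i%:R - 1) / i%:R / 2 * h.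
  by ring.
set S := \sum_(0 <= n < k) _; set t := _ * \sum_(0 <= n < k) _.
move=> St /andP[p0 p1]; rewrite -(subrK S (_ * _)) -addrA.
rewrite (le_trans (ler_normD _ _))// [leRHS]addrC lerD// ler_norml p1 andbT.
by rewrite (le_trans _ p0)// lerN10.
Qed.

(** * Gram-Schmidt coefficients and the conclusion *)

(** [c] lists the coordinates of e_(n+2) in f_2, ..., f_(n+2), and p = <e_(n+2), f_(n+2)>. The
    matrix identity records orthogonality to f_2, ..., f_(n+1). *)
Lemma gram_schmidt_coef (R : realType) (e : nat -> R -> R) (n : nat) :
  gram_schmidt_of_f e ->
  exists (c : 'rV[R]_n.+1) (p : R), [/\ 0 < p, 0 < c 0 ord_max,
    c *m (\matrix_(r < n.+1, s < n.+1) ip (@f R r.+2) (f s.+2)) =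
      p *: delta_mx 0 ord_max &
    forall k, (0 < k)%N ->
      ip (e n.+2) (f k) = \sum_r c 0 r * ip (@f R r.+2) (f k)].
Proof.
case=> eL eO eS eP.
have fL i : (2 <= i)%N -> @f R i \in Lfun (mu01 R) 2%:E.
  by move=> i2; apply: f_Lfun; exact: ltnW.
have mem_span (u : nat -> R -> R) i m : (2 <= i <= m)%N ->
    u i \in Lfun (mu01 R) 2%:E -> L2span u m (u i).
  move=> /andP[i2 im] uL; split=> //; exists (fun l => (l == i)%:R).
  apply: (@filterE _ _ (ae_filter_ringOfSetsType (mu01 R))) => x _.
  under eq_bigr do rewrite mulrC mulr_natr mulrb.
  by rewrite -big_mkcond big_nat1_eq i2 ltnS im.
have [_ [c ec]] : L2span (@f R) n.+2 (e n.+2).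
  by rewrite -eS//; apply: mem_span; [rewrite /= leqnn|exact: eL].
have cE g : g \in Lfun (mu01 R) 2%:E ->
    ip (e n.+2) g = \sum_(r < n.+1) c r.+2 * ip (@f R r.+2) g.
  by move=> gL; rewrite (ip_ae_sum fL (eL n.+2 isT) gL ec) !big_add1 big_mkord.
(* f_(s+2) lies in the span of e_2, ..., e_(n+1), all orthogonal to e_(n+2). *)
have e_perp s : (s < n)%N -> ip (e n.+2) (f s.+2) = 0.
  move=> sn; have n2 : (2 <= n.+1)%N by rewrite ltnS (leq_trans _ sn).
  have [_ [b fb]] : L2span e n.+1 (@f R s.+2).
    by rewrite eS//; apply: mem_span; [rewrite /= ltnS|exact: fL].
  rewrite ip_sym (ip_ae_sum eL (fL s.+2 isT) (eL n.+2 isT) fb).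
  rewrite big_nat big1// => i /andP[i2 isn]; rewrite eO// ltn_eqF ?mulr0//.
exists (\row_r c r.+2), (ip (e n.+2) (f n.+2)).
have p0 := eP n.+2 isT.
split=> //.
(* Expanding one factor of <e_(n+2), e_(n+2)> = 1 leaves only the last term: the last coordinate
   times p is 1. *)
- rewrite mxE -(pmulr_lgt0 _ p0).
  have := eO n.+2 n.+2 isT isT; rewrite eqxx cE ?eL// big_ord_recr/= big1.
    by rewrite add0r ip_sym => ->.
  by move=> r _; rewrite ip_sym e_perp ?mulr0.
- apply/rowP => s; rewrite !mxE eqxx/=.
  under eq_bigr do rewrite !mxE.
  rewrite -cE ?fL//; have [->|sn] := eqVneq s ord_max; first by rewrite mulr1.
  by rewrite e_perp ?mulr0// ltn_neqAle -ltnS ltn_ord andbT.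
- by move=> k k0; rewrite cE ?f_Lfun//; apply: eq_bigr => r _; rewrite mxE.
Qed.

Theorem theorem12 (R : realType) (e : nat -> R -> R)
    (he : gram_schmidt_of_f e) (j : nat) (hj : (2 <= j)%N) (hH : 0 < H R j) :
  exists k0 : nat, forall k : nat, (k0 <= k)%N -> 0 < ip (e j) (f k).
Proof.
case: j hj hH => [|[|n]]// _; rewrite /H /=; set M := (\matrix_(_, _) _) => hH.
have [c [p [p0 c0 cG ek]]] := gram_schmidt_coef n he.
(* Half of [cv] is the coefficient of the harmonic number in k <e_j, f_k>. *)
pose cv : R := \sum_r c 0 r * (r.+1%:R / r.+2%:R).
have cv0 : 0 < cv.
  have cM : c *m M = cv *: delta_mx 0 ord_max.
    apply/rowP => s; rewrite !mxE eqxx/=.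
    have [->|sn] := eqVneq s ord_max.
      by rewrite mulr1; apply: eq_bigr => r _; rewrite !mxE ltnn.
    (* Off the last column, [M] agrees with the Gram matrix. *)
    have /rowP/(_ s) := cG; rewrite !mxE eqxx (negbTE sn) !mulr0 => cs; rewrite -[RHS]cs.
    apply: eq_bigr => r _; rewrite !mxE !ltnS.
    by rewrite ltn_neqAle -ltnS ltn_ord andbT sn.
  have := row_mul_det cM.
  (* Deleting the last row and column leaves the Gram matrix of f_2, ..., f_(j-1), as j = n + 2. *)
  have -> : row' ord_max (col' ord_max M) =
      \matrix_(r < n, s < n) ip (@f R r.+2) (f s.+2) :> 'M[R]_n.
    by apply/matrixP => r s; rewrite !mxE !lift_max !ltnS ltn_ord.
  have G0 : 0 < \det (\matrix_(r < n, s < n) ip (@f R r.+2) (f s.+2)).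
    apply: (@det_gram_gt0 _ (fun r s => ip (@f R r.+2) (f s.+2))) => m.
    by have [c' [p' [? ? ? _]]] := gram_schmidt_coef m he; exists c', p'.
  move=> cvG; suff : 0 < cv * \det (\matrix_(r < n, s < n) ip (@f R r.+2) (f s.+2)).
    by rewrite pmulr_lgt0.
  by rewrite -cvG mulr_gt0.
(* The index is shifted to make it positive: [C r.+1] is the error bound for f_(r+2). *)
have [C CP] := choice (fun i => ip_f_asymptotic R (ltn0Sn i)).
pose B := \sum_r `|c 0 r| * C r.+1.
(* The main term [h * (cv / 2)] has to exceed [B], which bounds the total error [D]. *)
have [k0 k0P] := harmonic_unbounded (B / (cv / 2)).
exists (maxn 1 k0) => k; rewrite geq_max => /andP[k1 /k0P].
set h := \sum_(0 <= m < k) _; rewrite ltr_pdivrMr ?divr_gt0// => hB.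
have k_gt0 : 0 < k%:R :> R by rewrite ltr0n.
rewrite -(pmulr_rgt0 _ k_gt0) ek// mulr_sumr.
have -> : \sum_r k%:R * (c 0 r * ip (@f R r.+2) (f k)) = h * (cv / 2) +
    \sum_r c 0 r * (k%:R * ip (@f R r.+2) (f k) - r.+1%:R / r.+2%:R / 2 * h).
  rewrite mulrA mulr_sumr mulr_suml -big_split/=; apply: eq_bigr => r _.
  by ring.
set D := \sum_r _.
have : `|D| <= B.
  rewrite (le_trans (ler_norm_sum _ _ _))//; apply: ler_sum => r _.
  rewrite normrM ler_wpM2l//; have := CP r.+1 k k1.
  by have -> : r.+2%:R - 1 = r.+1%:R :> R by rewrite -natr1 addrK.
by rewrite ler_norml => /andP[DB _]; lra.
Qed.
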